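(* Let $X$ be a complex Hilbert space with open unit ball $B$, let $0\le\alpha<1$, and let $f:B\to X$ be a locally biholomorphic mapping. If $$\big\|Df(z)^{-1}D^2f(z)(x,x)\big\|\le 1-\alpha$$ for all $z\in B\setminus\{0\}$ and all $x\in X$ with $\|x\|=1$ and $\mathrm{Re}\,\langle x,z\rangle=0$, then $f$ is a biholomorphic convex mapping of order $\alpha$ on $B$.
   Context: $X$ is a complex Hilbert space with inner product $\langle\cdot,\cdot\rangle$ and norm $\|\cdot\|$, and $B=\{z\in X:\|z\|<1\}$. $Df(z)$ and $D^2f(z)$ denote the first and second Fréchet derivatives of a holomorphic mapping $f$ at $z$. A holomorphic mapping $f:B\to X$ is locally biholomorphic if every point of $B$ has a neighborhood on which $f$ is biholomorphic (onto its image, with holomorphic inverse); equivalently, $Df(z)$ has a bounded inverse at each $z\in B$. For $0\le\alpha<1$, a locally biholomorphic mapping $f:B\to X$ is called a biholomorphic convex mapping of order $\alpha$ on $B$ if $$\|x\|^2-\mathrm{Re}\,\big\langle Df(z)^{-1}D^2f(z)(x,x),z\big\rangle>\alpha\|x\|^2$$ for all $z\in B\setminus\{0\}$ and $x\in X\setminus\{0\}$ with $\mathrm{Re}\,\langle x,z\rangle=0$. *)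

(* Defs.v *)
From HB Require Import structures.
From mathcomp Require Import all_boot all_order all_algebra sesquilinear.
From mathcomp Require Import complex.
From mathcomp Require Import all_classical all_reals all_analysis.

Set Implicit Arguments.
Unset Strict Implicit.
Unset Printing Implicit Defensive.
Import Order.TTheory GRing.Theory Num.Theory.
Import numFieldNormedType.Exports.
Local Open Scope classical_set_scope.
Local Open Scope ring_scope.
Local Open Scope complex_scope.

Section HolomorphicMaps.
Context {R : realType} {X : completeNormedModType R[i]}.
Implicit Types (U : set X) (f : X -> X) (z : X).

Definition unit_ball : set X := [set z | `|z| < 1].

(* The scalar field is R[i], so [differentiable] is complex Frechet
   differentiability.  Maps on [unit_ball] are total functions [X -> X]; every
   notion below depends only on their germs at points of the ball. *)
Definition holomorphic_on U f : Prop := forall z, U z -> differentiable f z.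

(* In infinite dimension the image of an open set under an injective holomorphic
   map need not be open, hence the separate requirement on [f @` U]. *)
Definition biholomorphic_on U f : Prop :=
  [/\ open U, holomorphic_on U f, open (f @` U) &
      exists2 g : X -> X, holomorphic_on (f @` U) g &
        forall z, U z -> g (f z) = z].

Definition locally_biholomorphic f : Prop :=
  holomorphic_on unit_ball f /\
  forall z, unit_ball z ->
    exists U, [/\ U z, U `<=` unit_ball & biholomorphic_on U f].

(* [A] is the derivative at [z] of [w |-> 'd f w], as a map into the bounded
   operators on [X] with the operator norm; the last clause says that
   [Df(z + h) - Df(z) - A h] has operator norm at most [e * `|h|]. *)
Definition is_diff2 f z (A : X -> X -> X) : Prop :=
  [/\ (forall y, linear (A^~ y)), (forall h, linear (A h)),
      (exists M : R, forall h y, `|A h y| <= M%:C * `|h| * `|y|) &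
      forall e : R, 0 < e -> \forall h \near (0 : X), forall y,
        `|'d f (z + h) y - 'd f z y - A h y| <= e%:C * `|h| * `|y|].

(* As for ['d], the value is meaningful only where the derivative exists, hence
   everywhere on an open set where [f] is holomorphic. *)
Definition diff2 f z : X -> X -> X := xget (fun _ _ => 0) [set A | is_diff2 f z A].

(* The inverse operator of ['d f z] whenever the latter is bijective. *)
Definition diff_inv f z : X -> X := 'pinv_(fun=> 0) [set: X] ('d f z).

(* [dot] is linear in its first and conjugate linear in its second argument. *)
Definition biholomorphic_convex_of_order (dot : {dot X for Num.conj}) (alpha : R) f : Prop :=
  locally_biholomorphic f /\
  forall z x : X, unit_ball z -> z != 0 -> x != 0 -> 'Re (dot x z) = 0 ->
    `|x| ^+ 2 - 'Re (dot (diff_inv f z (diff2 f z x x)) z)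
      > alpha%:C * `|x| ^+ 2.

End HolomorphicMaps.

(* Main.v *)
Require Import Defs.
From HB Require Import structures.
From mathcomp Require Import all_boot all_order all_algebra sesquilinear.
From mathcomp Require Import complex.
From mathcomp Require Import all_classical all_reals all_analysis.
From mathcomp Require Import ring.

Import Order.TTheory GRing.Theory Num.Theory.
Import numFieldNormedType.Exports.
Local Open Scope classical_set_scope.
Local Open Scope ring_scope.
Local Open Scope complex_scope.

(** Both sides of the convexity inequality are homogeneous of degree two under
    real scaling of [x], because [D^2 f(z)] is bilinear and [Df(z)^-1] is
    linear.  So it suffices to consider a unit vector [u] with
    [Re <u, z> = 0], where the hypothesis and the Cauchy-Schwarz inequality
    give
    [[
      Re <Df(z)^-1 D^2 f(z)(u, u), z> <= (1 - alpha) |z| < 1 - alpha,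
    ]]
    the strictness coming from [|z| < 1] and [alpha < 1].

    The linearity of [diff_inv f z] rests on ['d f z] being bijective, since
    [diff_inv] selects preimages arbitrarily otherwise.  Bijectivity follows
    from the chain rule applied to a local holomorphic inverse
    ([locally_biholomorphic_diff_bij]). *)

(** Expanding [0 <= |b u - a v|^2] with [a = |u|] and [b = |v|] gives
    [0 <= 2 a b (a b - Re <u, v>)]. *)
Lemma Re_dot_le {C : numClosedFieldType} {X : normedModType C}
    {dot : {dot X for Num.conj}}
    (dot_norm : forall x : X, `|x| ^+ 2 = dot x x) (u v : X) :
  'Re (dot u v) <= `|u| * `|v|.
Proof.
have [->|u0] := eqVneq u 0; first by rewrite linear0l raddf0 normr0 mul0r.
have [->|v0] := eqVneq v 0; first by rewrite linear0r raddf0 normr0 mulr0.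
have uv_gt0 : 0 < (`|u| * `|v|) *+ 2.
  by rewrite pmulrn_rgt0 // mulr_gt0 ?normr_gt0.
have uv_ge0 : 0 <= `|u| * `|v| by rewrite mulr_ge0.
have := dnorm_ge0 dot (`|v| *: u - `|u| *: v).
rewrite dnormB !dnormZ -!dot_norm !normr_id.
have -> : dot (`|v| *: u) (`|u| *: v) = (`|u| * `|v|) * dot u v.
  by rewrite linearZl_LR linearZr_LR /= geC0_conj // mulrA (mulrC `|v|).
rewrite rmorphM /= (geC0_conj uv_ge0) //.
have -> : `|v| ^+ 2 * `|u| ^+ 2 + `|u| ^+ 2 * `|v| ^+ 2 -
    (`|u| * `|v| * dot u v + `|u| * `|v| * (dot u v)^*) =
    (`|u| * `|v|) *+ 2 * (`|u| * `|v| - 'Re (dot u v)).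
  by rewrite ReE; field.
by rewrite pmulr_rge0 ?subr_ge0.
Qed.

Lemma Re_dotZl {C : numClosedFieldType} {X : lmodType C}
    (dot : {dot X for Num.conj}) (c : C) (u v : X) : c \is Num.real ->
  'Re (dot (c *: u) v) = c * 'Re (dot u v).
Proof. by move=> cR; rewrite linearZl_LR /= ReMl. Qed.

Lemma diff_near_id {K : numFieldType} {V : normedModType K}
    {h : V -> V} {x : V} :
  {near x, h =1 id} -> 'd h x = id :> (V -> V).
Proof.
move=> hid.
have hx : h x = x by exact: (nbhs_singleton hid).
apply: (@diff_unique _ _ _ h idfun) => //; first by move=> y; exact: cvg_id.
apply/eqaddoP => _/posnumP[e].
move: hid; rewrite (near_shift 0 x) subr0.
apply: filterS => y /= hyx.
by rewrite -[X in `|X| <= _]/(h (y + x) - (h x + y)) hyx hx (addrC x) subrr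
  normr0 mulr_ge0.
Qed.

Lemma diff_bij_of_local_inverse {K : numFieldType} {V : normedModType K}
    (f g : V -> V) (z : V) :
  differentiable f z -> differentiable g (f z) ->
  {near z, g \o f =1 id} -> {near f z, f \o g =1 id} -> bijective ('d f z).
Proof.
move=> df dg gf fg.
have gfz : g (f z) = z by exact: (nbhs_singleton gf).
have dgf : 'd g (f z) \o 'd f z = id by rewrite -diff_comp // diff_near_id.
have dfg : 'd f z \o 'd g (f z) = id.
  have df' : differentiable f (g (f z)) by rewrite gfz.
  by have := diff_comp dg df'; rewrite gfz (diff_near_id fg); move=> <-.
exists ('d g (f z)) => y.
  exact: (congr1 (@^~ y) dgf).
exact: (congr1 (@^~ y) dfg).
Qed.

(** The image of a neighbourhood on which [f] is biholomorphic is open, so the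
    inverse map is a two-sided inverse on neighbourhoods of [z] and [f z]. *)
Lemma locally_biholomorphic_diff_bij {R : realType}
    {X : completeNormedModType R[i]} (f : X -> X) (z : X) :
  locally_biholomorphic f -> unit_ball z -> bijective ('d f z).
Proof.
move=> [fhol floc] zB.
have [U [Uz UB [Uo _ fUo [g ghol gK]]]] := floc z zB.
apply: (diff_bij_of_local_inverse f g).
- exact: fhol.
- by apply: ghol; exists z.
- by apply: filterS (open_nbhs_nbhs (conj Uo Uz)) => w /gK.
- apply: filterS (open_nbhs_nbhs (conj fUo (imageP f Uz))) => _ [w Uw <-] /=.
  by rewrite gK.
Qed.

Lemma diff_invZ {R : realType} {X : completeNormedModType R[i]}
    (f : X -> X) (z : X) (c : R[i]) (v : X) :
  bijective ('d f z) -> diff_inv f z (c *: v) = c *: diff_inv f z v.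
Proof.
move=> bij; have invK w : 'd f z (diff_inv f z w) = w.
  rewrite /diff_inv pinvK // inE.
  by have [g _ gK] := bij; exists (g w).
by apply: (bij_inj bij); rewrite linearZ /= !invK.
Qed.

(** When no second derivative exists, [diff2 f z] is the zero map, which is
    homogeneous too. *)
Lemma diff2Z {R : realType} {X : completeNormedModType R[i]}
    (f : X -> X) (z : X) (c : R[i]) (x : X) :
  diff2 f z (c *: x) (c *: x) = c ^+ 2 *: diff2 f z x x.
Proof.
rewrite /diff2; case: xgetP => [A _ [lin1 lin2 _ _]|_]; last by rewrite scaler0.
have hZ (g : X -> X) w : linear g -> g (c *: w) = c *: g w.
  move=> glin.
  pose G := HB.pack g (GRing.isLinear.Build _ _ _ _ g glin) : {linear X -> X}.
  exact: (linearZ_LR G).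
by rewrite (hZ _ _ (lin1 _)) (hZ _ _ (lin2 _)) scalerA expr2.
Qed.

Theorem theorem1 (R : realType) (X : completeNormedModType R[i])
    (dot : {dot X for Num.conj})
    (dot_norm : forall x : X, `|x| ^+ 2 = dot x x)
    (alpha : R) (alpha_ge0 : 0 <= alpha) (alpha_lt1 : alpha < 1)
    (f : X -> X) (f_locbihol : locally_biholomorphic f)
    (f_bound : forall z x : X, unit_ball z -> z != 0 ->
       `|x| = 1 -> 'Re (dot x z) = 0 ->
       `|diff_inv f z (diff2 f z x x)| <= (1 - alpha)%:C) :
  biholomorphic_convex_of_order dot alpha f.

Proof.
split=> // z x zB z0 x0 xz.
have nx : 0 < `|x| by rewrite normr_gt0.
pose k := `|x|; pose u := k^-1 *: x.
have xE : x = k *: u by rewrite scalerA divff ?scale1r // gt_eqF.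
have kr : k \is Num.real by exact: gtr0_real.
have u1 : `|u| = 1 by rewrite normrZ normfV normr_id mulVf // gt_eqF.
have uz : 'Re (dot u z) = 0 by rewrite Re_dotZl ?rpredV // xz mulr0.
set w := diff_inv f z (diff2 f z u u).
have wz : 'Re (dot w z) < (1 - alpha)%:C.
  apply: (le_lt_trans (Re_dot_le dot_norm _ _)).
  apply: (@le_lt_trans _ _ ((1 - alpha)%:C * `|z|)).
    by rewrite ler_wpM2r // f_bound.
  by rewrite -[ltRHS]mulr1 ltr_pM2l // ltcR subr_gt0.
have bij := locally_biholomorphic_diff_bij _ _ f_locbihol zB.
rewrite -/k xE diff2Z (diff_invZ _ _ _ _ bij) Re_dotZl ?rpredX // -/w.
rewrite mulrC -subr_gt0.
rewrite -[X in X - _ - _]mulr1 -!mulrBr mulr_gt0 ?exprn_gt0 //.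
by move: wz; rewrite rmorphB rmorph1 addrAC subr_gt0.
Qed.
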